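(* Let $c>0$ and $\delta\ge 0$ be fixed real numbers and let $c_k=c^2k^{2\delta}$ for $k\ge 1$. Let $p_{-1}=0$, $p_0=1$ and $p_{k+1}(x)=x\,p_k(x)-c_k\,p_{k-1}(x)$ for $k\ge 0$ (with $c_0=0$), and let $x_{kk}$ denote the largest zero of $p_k$. Then for all $k\ge 2$, $$x_{kk}\,k^{-\delta}<2c\,\sqrt{1-\frac{\delta^{2/3}}{\left(\left(k+\frac12\right)^{1/3}+\delta^{1/3}\right)^2}}\,.$$
   Context: Each $p_k$ is a monic real polynomial of degree $k$, belonging to a family of symmetric orthogonal polynomials ($p_k(-x)=(-1)^kp_k(x)$); all its zeros are real and simple. *)

(* Defs.v *)
From mathcomp Require Import all_boot all_order all_algebra.
From mathcomp Require Import all_classical all_reals all_analysis.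

Set Implicit Arguments.
Unset Strict Implicit.
Unset Printing Implicit Defensive.

Import Order.TTheory GRing.Theory Num.Theory.
Local Open Scope ring_scope.

(* The monic polynomials with p_{-1} = 0, p_0 = 1 and
   p_{k+1} = 'X p_k - c_k p_{k-1}.  As p_{-1} = 0, the step k = 0 reads
   p_1 = 'X, and the value of c at 0 is never used. *)
Fixpoint sym_opoly (R : realType) (c : nat -> R) (k : nat) : {poly R} :=
  if k is k1.+1 then
    if k1 is k2.+1 then 'X * sym_opoly c k1 - c k1 *: sym_opoly c k2
    else 'X
  else 1.

(* c_k = c^2 k^(2 delta) for k >= 1, and c_0 = 0. The case k = 0 is separate
   because 0 `^ 0 = 1. *)
Definition pow_coef (R : realType) (c delta : R) (k : nat) : R :=
  if k is 0%N then 0 else c ^+ 2 * k%:R `^ (2 * delta).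

Definition is_largest_zero (R : realType) (p : {poly R}) (x : R) : Prop :=
  root p x /\ forall y : R, root p y -> y <= x.

(* Main.v *)
Require Import Defs.
From mathcomp Require Import all_boot all_order all_algebra.
From mathcomp Require Import all_classical all_reals all_analysis.
From mathcomp Require Import ring lra.

Set Implicit Arguments.
Unset Strict Implicit.

Import Order.TTheory GRing.Theory Num.Theory.
Local Open Scope ring_scope.

(* The ratios r_j = p_j / p_{j-1} satisfy r_{j+1} = y - c_j / r_j, so positive
   lower bounds h_j for them propagate as long as c_j / h_j + h_{j+1} <= y; if
   this works up to j = k for every y >= l, then p_k > 0 on [l, oo) and the
   largest zero is below l. With K = k + 1/2, rho = (delta / K)^(1/3) and
   s^2 = (1 + 2 rho) / (1 + rho)^2, the claimed bound is l = 2 c k^delta s, and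
   h_j = c k^delta s t_{k-j} with
     t_n = 1 + rho^2 n / ((1 + rho) (1 + rho n))
   is admissible: (k/j)^(2 delta) >= 1 + 2 delta (k - j) / k
   >= 1 + 2 rho^3 (k - j) reduces the condition to an inequality between
   polynomials in rho and n - 1 all of whose coefficients are nonnegative. *)

Lemma sym_opoly_gt0 (R : realType) (c h : nat -> R) (y : R) (k : nat) :
    (forall j, (j < k)%N -> 0 < h j.+1) ->
    ((0 < k)%N -> h 1%N <= y) ->
    (forall j, (0 < j < k)%N -> 0 <= c j /\ c j / h j + h j.+1 <= y) ->
  0 < (sym_opoly c k).[y].
Proof.
move=> hpos h1 hstep.
(* The bound [h j.+1] on the ratio is kept in product form. The induction carries positivity along
   with it, so that the ratio at [j.+1] makes sense. *)
suff H j : (j < k)%N -> 0 < (sym_opoly c j).[y] /\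
    h j.+1 * (sym_opoly c j).[y] <= (sym_opoly c j.+1).[y].
  case: k hpos h1 hstep H => [|k] hpos _ _ H; first by rewrite /= hornerC.
  have [pk0 /lt_le_trans] := H k (ltnSn k); apply.
  by rewrite mulr_gt0 ?hpos.
elim: j => [|j IHj] ltjk.
  by rewrite /= hornerX hornerC mulr1 ltr01 h1.
have [pj0 ratio_j] := IHj (ltnW ltjk).
have hj0 : 0 < h j.+1 := hpos j (ltnW ltjk).
have pj1_gt0 : 0 < (sym_opoly c j.+1).[y].
  by apply: lt_le_trans ratio_j; rewrite mulr_gt0.
split=> //.
have [cj0 stepj] := hstep j.+1 ltjk.
have -> : (sym_opoly c j.+2).[y] =
    y * (sym_opoly c j.+1).[y] - c j.+1 * (sym_opoly c j).[y].
  by rewrite /= hornerD hornerN hornerZ hornerM hornerX.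
have : c j.+1 * (sym_opoly c j).[y] <= c j.+1 / h j.+1 * (sym_opoly c j.+1).[y].
  by rewrite -mulrA ler_wpM2l // ler_pdivlMl.
have := ler_wpM2r (ltW pj1_gt0) stepj.
by rewrite mulrDl; lra.
Qed.

(** With [d * ln (y / x)] as exponent, [expR] lies above its tangent at 0, and
    [ln (y / x) = - ln (x / y)] is at least [1 - x / y]. This covers every [d >= 0], including
    [d < 1]. *)
Lemma powR_Bernoulli_inv (R : realType) (x y d : R) :
  0 < x -> 0 < y -> 0 <= d -> x `^ d * (1 + d * (1 - x / y)) <= y `^ d.
Proof.
move=> x0 y0 d0.
have -> : y `^ d = x `^ d * (y / x) `^ d.
  by rewrite -powRM ?divr_ge0 ?ltW // mulrCA divff ?mulr1 // gt_eqF.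
rewrite ler_wpM2l ?powR_ge0 // /powR gt_eqF ?divr_gt0 //.
apply: le_trans (expR_ge1Dx _); rewrite lerD2l ler_wpM2l //.
have xy0 : 0 < x / y by rewrite divr_gt0.
have := @le_ln1Dx R (x / y - 1); rewrite (addrCA 1) subrr addr0.
rewrite -[y / x]invf_div lnV ?posrE //.
have : -1 < x / y - 1 by lra.
by move=> /[swap] /[apply]; lra.
Qed.

Definition ratio_bound (R : realFieldType) (r x : R) : R :=
  1 + r ^+ 2 * x / ((1 + r) * (1 + r * x)).

Lemma ratio_bound_ge1 (R : realFieldType) (r x : R) :
  0 <= r -> 0 <= x -> 1 <= ratio_bound r x.
Proof.
move=> r0 x0; rewrite /ratio_bound lerDl divr_ge0 ?mulr_ge0 ?exprn_ge0 //.
  by rewrite addr_ge0.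
by rewrite addr_ge0 ?mulr_ge0.
Qed.

Lemma ratio_bound_le2 (R : realFieldType) (r x : R) :
  0 <= r -> 0 <= x -> ratio_bound r x <= 2.
Proof.
move=> r0 x0; rewrite /ratio_bound (_ : 2 = 1 + 1 :> R) // lerD2l.
have rx0 : 0 <= r * x by rewrite mulr_ge0.
rewrite ler_pdivrMr ?mul1r ?mulr_gt0 ?ltr_wpDr //.
by rewrite -subr_ge0 (_ : _ - _ = 1 + r + r * x); [lra | ring].
Qed.

(** This is the admissibility condition at [k - j = m + 1]: the first factor bounds
    [(k / j) ^ (2 delta)] from below and the second is [s ^ 2]. *)
Lemma ratio_bound_step (R : realFieldType) (r m : R) : 0 <= r -> 0 <= m ->
  1 <= (1 + 2 * r ^+ 3 * (m + 1)) * ((1 + 2 * r) / (1 + r) ^+ 2)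
       * (ratio_bound r (m + 1) * (2 - ratio_bound r m)).
Proof.
move=> r0 m0; rewrite /ratio_bound.
have rm0 : 0 <= r * m by rewrite mulr_ge0.
have d1 : 0 < 1 + r by lra.
have d2 : 0 < 1 + r * m by lra.
have d3 : 0 < 1 + r * (m + 1) by lra.
pose D := (1 + r) ^+ 4 * ((1 + r * m) * (1 + r * (m + 1))).
have D0 : 0 < D by rewrite !mulr_gt0 ?exprn_gt0.
rewrite -subr_ge0.
have -> : (1 + 2 * r ^+ 3 * (m + 1)) * ((1 + 2 * r) / (1 + r) ^+ 2)
   * ((1 + r ^+ 2 * (m + 1) / ((1 + r) * (1 + r * (m + 1))))
      * (2 - (1 + r ^+ 2 * m / ((1 + r) * (1 + r * m))))) - 1 =
  (2 * r ^+ 3 + r ^+ 4 * (9 + 8 * m + 2 * m ^+ 2)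
   + r ^+ 5 * (19 + 32 * m + 16 * m ^+ 2 + 2 * m ^+ 3)
   + r ^+ 6 * (20 + 47 * m + 35 * m ^+ 2 + 8 * m ^+ 3)
   + r ^+ 7 * (8 + 24 * m + 24 * m ^+ 2 + 8 * m ^+ 3)) / D.
  by rewrite /D; field; rewrite !gt_eqF.
by rewrite divr_ge0 ?(ltW D0) // !(addr_ge0, mulr_ge0, exprn_ge0).
Qed.

Theorem theorem2 (R : realType) (c delta : R) (hc : 0 < c) (hdelta : 0 <= delta)
    (k : nat) (hk : (2 <= k)%N) (xkk : R)
    (hx : is_largest_zero (sym_opoly (pow_coef c delta) k) xkk) :
  xkk * k%:R `^ (- delta) <
  2 * c * Num.sqrt
    (1 - delta `^ (2 / 3) /
         ((k%:R + 1 / 2) `^ (1 / 3) + delta `^ (1 / 3)) ^+ 2).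
Proof.
have cube_root (x : R) : 0 <= x -> (x `^ (1 / 3)) ^+ 3 = x.
  move=> x0; rewrite -powR_mulrn ?powR_ge0 // -powRrM.
  by rewrite (_ : 1 / 3 * 3%:R = 1) ?powRr1 //; field.
have k0 : 0 < k%:R :> R by rewrite ltr0n (ltn_trans _ hk).
have K0 : 0 < k%:R + 1 / 2 :> R by lra.
have -> : delta `^ (2 / 3) = (delta `^ (1 / 3)) ^+ 2.
  by rewrite -powR_mulrn ?powR_ge0 // -powRrM; congr (_ `^ _); field.
have a3 := cube_root _ hdelta; have b3 := cube_root _ (ltW K0).
have a0 : 0 <= delta `^ (1 / 3) by exact: powR_ge0.
have b0 : 0 < (k%:R + 1 / 2) `^ (1 / 3) :> R by exact: powR_gt0.
set a := delta `^ (1 / 3) in a3 a0 *.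
set b := (k%:R + 1 / 2) `^ (1 / 3) in b3 b0 *.
pose r := a / b.
have r0 : 0 <= r by rewrite divr_ge0 // ltW.
have -> : 1 - a ^+ 2 / (b + a) ^+ 2 = (1 + 2 * r) / (1 + r) ^+ 2.
  by rewrite /r; field; rewrite !gt_eqF //; lra.
(* The cube of [r] is [delta / (k + 1/2)], at most [delta / k]. *)
have r3k : r ^+ 3 * k%:R <= delta.
  by rewrite /r expr_div_n a3 b3 mulrAC ler_pdivrMr // ler_wpM2l //; lra.
set S := (1 + 2 * r) / (1 + r) ^+ 2.
have S0 : 0 < S by rewrite divr_gt0 ?exprn_gt0 //; lra.
have kd0 : 0 < k%:R `^ delta :> R by exact: powR_gt0.
rewrite powRN ltr_pdivrMr //.
(* Half of the claimed bound, so that [h_j] is [D * t (k - j)] and the threshold for [xkk] is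
   [2 * D]. *)
pose D := c * k%:R `^ delta * Num.sqrt S.
have D0 : 0 < D by rewrite !mulr_gt0 ?sqrtr_gt0.
have D2 : D ^+ 2 = c ^+ 2 * k%:R `^ (2 * delta) * S.
  rewrite !exprMn sqr_sqrtr ?(ltW S0) //; congr (_ * _ * _).
  by rewrite -powR_mulrn ?powR_ge0 // -powRrM mulrC.
rewrite (_ : 2 * c * _ * _ = 2 * D); last by rewrite /D; ring.
rewrite ltNge; apply/negP => lex.
have [/rootP px0 _] := hx.
suff : 0 < (sym_opoly (pow_coef c delta) k).[xkk] by rewrite px0 ltxx.
pose t n := ratio_bound r n%:R.
have t0 n : 0 < t n by apply: lt_le_trans (ratio_bound_ge1 r0 _).
have t2 n : t n <= 2 by apply: ratio_bound_le2.
apply: (@sym_opoly_gt0 _ _ (fun j => D * t (k - j)%N)) => [j _|_|j].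
- by rewrite mulr_gt0.
(* The initial condition follows from [t <= 2]. *)
- by apply: le_trans lex; rewrite mulrC ler_wpM2r ?(ltW D0).
case/andP=> j0 ltjk.
have jR0 : 0 < j%:R :> R by rewrite ltr0n.
have -> : pow_coef c delta j = c ^+ 2 * j%:R `^ (2 * delta) by case: (j) j0.
split; first by rewrite mulr_ge0 ?powR_ge0 ?exprn_ge0 ?(ltW hc).
apply: le_trans lex.
have -> : (k - j = (k - j.+1).+1)%N by rewrite subnSK.
set m := (k - j.+1)%N.
have kE : k%:R = j%:R + (m%:R + 1) :> R.
  by rewrite natr1 -natrD subnSK // subnKC // ltnW.
(* Bernoulli between [j] and [k], where [1 - j / k = (m + 1) / k]; then [r3k] replaces [delta / k]
   by [r ^+ 3]. *)
have powr_le : j%:R `^ (2 * delta) * (1 + 2 * r ^+ 3 * (m%:R + 1))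
    <= k%:R `^ (2 * delta).
  apply: le_trans (powR_Bernoulli_inv jR0 k0 _); last by rewrite mulr_ge0.
  rewrite ler_wpM2l ?powR_ge0 // lerD2l -[leLHS]mulrA -[leRHS]mulrA ler_wpM2l //.
  have -> : 1 - j%:R / k%:R = (m%:R + 1) / k%:R :> R.
    by rewrite -[m%:R + 1](addKr j%:R) -kE; field; rewrite gt_eqF.
  by rewrite [leRHS]mulrA ler_pdivlMr // mulrAC ler_wpM2r // addr_ge0.
have step : j%:R `^ (2 * delta) <=
    k%:R `^ (2 * delta) * S * (t m.+1 * (2 - t m)).
  have T0 : 0 <= S * (t m.+1 * (2 - t m)).
    rewrite mulr_ge0 ?(ltW S0) // mulr_ge0 ?(ltW (t0 _)) //.
    by rewrite subr_ge0 t2.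
  rewrite -[leRHS]mulrA; apply: le_trans (ler_wpM2r T0 powr_le).
  rewrite -[leRHS]mulrA ler_peMr ?powR_ge0 // [leRHS]mulrA /t -[m.+1%:R]natr1.
  exact: ratio_bound_step.
(* Clearing the positive denominator [h_j = D * t m.+1] turns the condition into
   [c_j <= D ^+ 2 * (t m.+1 * (2 - t m))], which is [step] times [c ^+ 2]. *)
rewrite -lerBrDr ler_pdivrMr ?(mulr_gt0 D0 (t0 _)) //.
have -> : (2 * D - D * t m) * (D * t m.+1) = D ^+ 2 * (t m.+1 * (2 - t m)).
  by ring.
by rewrite D2 -(mulrA (c ^+ 2)) -(mulrA (c ^+ 2)) ler_wpM2l ?exprn_ge0 ?(ltW hc).
Qed.
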